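(* Fix $D\in\mathcal P_{\ell,u}$. (i) If a number $\hat N(D)\in[0,|D|]$ and a set $\hat G(D)\subseteq D$ satisfy $$\sum_{i\in D\setminus\hat G(D)}c_i^*(D)\le\hat N(D)-|\hat G(D)|<\sum_{i\in D\setminus\hat G(D)}\frac{I^*(D\setminus\hat G(D))}{I_i},\qquad(1)$$ then $\hat N(D)\ge\sum_{i\in D}c_i^*(D)$ and $\hat G(D)\supseteq\{i\in D:c_i^*(D)=1\}$. Respectively, if $\check N(D)\in[0,|D^c|]$ and $\check G(D)\subseteq D^c$ satisfy $$\sum_{i\in D^c\setminus\check G(D)}c_i^*(D)\le\check N(D)-|\check G(D)|<\sum_{i\in D^c\setminus\check G(D)}\frac{J^*(D^c\setminus\check G(D))}{J_i},\qquad(2)$$ then $\check N(D)\ge\sum_{i\notin D}c_i^*(D)$ and $\check G(D)\supseteq\{i\notin D:c_i^*(D)=1\}$. (ii) Let $\hat N(D)<|D|$ with $\hat N(D)\ge\sum_{i\in D}c_i^*(D)$. Let $\emptyset=\hat{\mathcal G}_0\subset\hat{\mathcal G}_1\subset\dots\subset\hat{\mathcal G}_{|D|}=D$ be a strictly increasing sequence of sets with $|\hat{\mathcal G}_k|=k$ and $I_i\le I_j$ for all $i\in\hat{\mathcal G}_k$, $j\in D\setminus\hat{\mathcal G}_k$, for every $k$. Then there is a smallest $k^*\in\{0,\dots,|D|\}$ such that $$\hat N(D)-k^*<\sum_{i\in D\setminus\hat{\mathcal G}_{k^*}}\frac{I^*(D\setminus\hat{\mathcal G}_{k^*})}{I_i},$$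 and the set $\hat G(D):=\hat{\mathcal G}_{k^*}$ satisfies (1). Respectively, let $\check N(D)<|D^c|$ with $\check N(D)\ge\sum_{i\notin D}c_i^*(D)$, and let $\emptyset=\check{\mathcal G}_0\subset\dots\subset\check{\mathcal G}_{|D^c|}=D^c$ be strictly increasing with $|\check{\mathcal G}_k|=k$ and $J_i\le J_j$ for all $i\in\check{\mathcal G}_k$, $j\in D^c\setminus\check{\mathcal G}_k$. Then there is a smallest $k^*\in\{0,\dots,|D^c|\}$ such that $\check N(D)-k^*<\sum_{i\in D^c\setminus\check{\mathcal G}_{k^*}}J^*(D^c\setminus\check{\mathcal G}_{k^*})/J_i$, and $\check G(D):=\check{\mathcal G}_{k^*}$ satisfies (2).
   Context: $M\in\mathbb N$, $[M]=\{1,\dots,M\}$; integers $0\le\ell\le u\le M$ with $\ell<M$, $u>0$; $\mathcal P_{\ell,u}=\{D\subseteq[M]:\ell\le|D|\le u\}$; $D^c=[M]\setminus D$. $K\in(0,M]$ is real, $I_i,J_i\in(0,\infty)$ for $i\in[M]$ (Kullback–Leibler divergences of the two hypotheses for source $i$), $I^*(D)=\min_{i\in D}I_i$, $J^*(D)=\min_{i\in D}J_i$; empty sums are $0$. $r\in(0,\infty)$ is fixed (used only when $\ell<u$). $c_i^*(A):=x(A)I^*(A)/I_i$ for $i\in A$, $c_i^*(A):=y(A)J^*(A^c)/J_i$ for $i\notin A$. With $\hat K(A):=\sum_{i\in A}I^*(A)/I_i$, $\check K(A^c):=\sum_{i\in A^c}J^*(A^c)/J_i$, $\theta_A:=I^*(A)/J^*(A^c)$,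 $z_A:=\theta_A/(r-1)$ (if $r>1$), $w_A:=(1/\theta_A)/(1/r-1)$ (if $r<1$), the numbers $x(A),y(A)$ are: - $\ell=u$: if $\hat K(A)\le\theta_A\check K(A^c)$, $x=(K/\hat K(A))\wedge1$, $y=((K-\hat K(A))^+/\check K(A^c))\wedge1$; otherwise $x=((K-\check K(A^c))^+/\hat K(A))\wedge1$, $y=(K/\check K(A^c))\wedge1$. - $\ell<|A|<u$: $x=\frac{K}{\hat K(A)+(\theta_A/r)\check K(A^c)}\wedge(r/\theta_A)\wedge1$, $y=(\theta_A/r)x$. - $|A|=\ell<u$: (1) if $\ell=0$ or $r\le1$: $x=0$, $y=(K/\check K(A^c))\wedge1$; (2) if $\ell>0$, $r>1$, $z_A<1$, $K>\hat K(A)+z_A\check K(A^c)$: $x=1$, $y=((K-\hat K(A))/\check K(A^c))\wedge1$; (3) if $\ell>0$, $r>1$ and ($z_A\ge1$ or $K\le\hat K(A)+z_A\check K(A^c)$): $x=\frac{K}{\hat K(A)+z_A\check K(A^c)}\wedge(1/z_A)\wedge1$, $y=\frac{K}{\check K(A^c)+(1/z_A)\hat K(A)}\wedge z_A\wedge1$. - $|A|=u>\ell$: (1) if $u=M$ or $r\ge1$: $x=(K/\hat K(A))\wedge1$, $y=0$; (2) if $u<M$, $r<1$, $w_A<1$, $K>\check K(A^c)+w_A\hat K(A)$: $x=((K-\check K(A^c))/\hat K(A))\wedge1$, $y=1$; (3) if $u<M$, $r<1$ and ($w_A\ge1$ or $K\le\check K(A^c)+w_A\hat K(A)$): $x=\frac{K}{\hat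 K(A)+(1/w_A)\check K(A^c)}\wedge w_A\wedge1$, $y=\frac{K}{\check K(A^c)+w_A\hat K(A)}\wedge(1/w_A)\wedge1$. *)

(* Defs.v *)
From mathcomp Require Import all_boot all_order all_algebra.
From mathcomp Require Import reals.

Set Implicit Arguments.
Unset Strict Implicit.
Unset Printing Implicit Defensive.

Import Order.TTheory GRing.Theory Num.Theory.
Local Open Scope ring_scope.

(* Sources are 0-based: [M] = {1, ..., M} is rendered as 'I_M. *)

(* The class P_{l,u}. *)
Definition admissible (M l u : nat) : {set {set 'I_M}} :=
  [set A : {set 'I_M} | (l <= #|A| <= u)%N].

(* min_{i in A} F i; I^*(A) is [min_over I A] and J^*(A) is [min_over J A].
   The value 0 at the empty set is a placeholder: every formula below only
   looks at the minimum over the empty set in branches that are not taken or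
   inside empty sums. *)
Definition min_over (R : realType) (M : nat) (F : 'I_M -> R)
    (A : {set 'I_M}) : R :=
  if [pick i in A] is Some i0 then \big[Num.min/F i0]_(i in A) F i else 0.

(* \hat K(A) is [ratio_sum I A] and \check K(A^c) is [ratio_sum J (~: A)]. *)
Definition ratio_sum (R : realType) (M : nat) (F : 'I_M -> R)
    (A : {set 'I_M}) : R :=
  \sum_(i in A) min_over F A / F i.

Definition pos_part (R : realType) (a : R) : R := Num.max a 0.

(* The pair (x(A), y(A)) in each regime, as a function of
   Kh = \hat K(A), Kc = \check K(A^c) and theta = theta_A. *)

Definition xy_fixed_size (R : realType) (K Kh Kc theta : R) : R * R :=
  if Kh <= theta * Kc then
    (Num.min (K / Kh) 1, Num.min (pos_part (K - Kh) / Kc) 1)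
  else
    (Num.min (pos_part (K - Kc) / Kh) 1, Num.min (K / Kc) 1).

Definition xy_interior (R : realType) (K r Kh Kc theta : R) : R * R :=
  let x := Num.min (K / (Kh + theta / r * Kc)) (Num.min (r / theta) 1) in
  (x, theta / r * x).

Definition xy_lower (R : realType) (l : nat) (K r Kh Kc theta : R) : R * R :=
  let z := theta / (r - 1) in
  if (l == 0%N) || (r <= 1) then
    (0, Num.min (K / Kc) 1)
  else if (z < 1) && (Kh + z * Kc < K) then
    (1, Num.min ((K - Kh) / Kc) 1)
  else
    (Num.min (K / (Kh + z * Kc)) (Num.min (1 / z) 1),
     Num.min (K / (Kc + 1 / z * Kh)) (Num.min z 1)).

Definition xy_upper (R : realType) (M u : nat) (K r Kh Kc theta : R) : R * R :=
  let w := (1 / theta) / (1 / r - 1) in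
  if (u == M) || (1 <= r) then
    (Num.min (K / Kh) 1, 0)
  else if (w < 1) && (Kc + w * Kh < K) then
    (Num.min ((K - Kc) / Kh) 1, 1)
  else
    (Num.min (K / (Kh + 1 / w * Kc)) (Num.min w 1),
     Num.min (K / (Kc + w * Kh)) (Num.min (1 / w) 1)).

(* (x(A), y(A)); only meaningful for A in [admissible M l u], so that the last
   branch is the regime |A| = u > l. *)
Definition xy (R : realType) (M l u : nat) (K r : R) (I J : 'I_M -> R)
    (A : {set 'I_M}) : R * R :=
  let Kh := ratio_sum I A in
  let Kc := ratio_sum J (~: A) in
  let theta := min_over I A / min_over J (~: A) in
  if l == u then xy_fixed_size K Kh Kc theta
  else if (l < #|A| < u)%N then xy_interior K r Kh Kc theta
  else if #|A| == l then xy_lower l K r Kh Kc theta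
  else xy_upper M u K r Kh Kc theta.

Definition cstar (R : realType) (M l u : nat) (K r : R) (I J : 'I_M -> R)
    (A : {set 'I_M}) (i : 'I_M) : R :=
  if i \in A then (xy l u K r I J A).1 * min_over I A / I i
  else (xy l u K r I J A).2 * min_over J (~: A) / J i.

(* Used with F = I, S = D, N = \hat N(D), G = \hat G(D), and with F = J,
   S = D^c, N = \check N(D), G = \check G(D); c is c^*(D) in both cases. *)
Definition sampling_condition (R : realType) (M : nat) (F c : 'I_M -> R)
    (S G : {set 'I_M}) (N : R) : Prop :=
  \sum_(i in S :\: G) c i <= N - #|G|%:R /\
  N - #|G|%:R < ratio_sum F (S :\: G).

(* Gs 0, ..., Gs #|S| is a strictly increasing sequence from the empty set to S
   that adds the elements of S in nondecreasing order of F; values of Gs beyond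
   #|S| are irrelevant. *)
Definition ordered_chain (R : realType) (M : nat) (F : 'I_M -> R)
    (S : {set 'I_M}) (Gs : nat -> {set 'I_M}) : Prop :=
  [/\ Gs 0%N = set0,
      Gs #|S| = S,
      forall k : nat, (k < #|S|)%N -> Gs k \proper Gs k.+1,
      forall k : nat, (k <= #|S|)%N -> #|Gs k| = k
    & forall (k : nat) (i j : 'I_M), (k <= #|S|)%N ->
        i \in Gs k -> j \in S :\: Gs k -> F i <= F j].

(* k is the smallest element of {0, ..., n} satisfying P. *)
Definition smallest_upto (n : nat) (P : nat -> Prop) (k : nat) : Prop :=
  [/\ (k <= n)%N, P k & forall k' : nat, (k' <= n)%N -> P k' -> (k <= k')%N].

(* Main.v *)
Require Import Defs.
From mathcomp Require Import all_boot all_order all_algebra.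
From mathcomp Require Import reals.

Set Implicit Arguments.
Unset Strict Implicit.
Unset Printing Implicit Defensive.

Import Order.TTheory GRing.Theory Num.Theory.
Local Open Scope ring_scope.

(** The two populations [D] and [~: D] play the same role: on either one, call
it [S], the frequencies are [c i = t * min_S F / F i] with a factor [t <= 1],
and nothing else about the regimes defining [(x, y)] matters.

(i) As [c <= 1], adding the elements of [G] back gives [sum_S c <= N].  If
[c i = 1] then [t = 1] and [i] minimizes [F] over [S]; were [i] outside [G], the
minima over [S] and [S :\: G] would coincide, so the two outer sums in (1) would
be equal, contradicting the strict inequality.

(ii) At [k = #|S|] the inequality reads [N - #|S| < 0].  If the smallest [k] is
positive, let [j] be the element added at step [k].  It minimizes [F] over
[S :\: Gs k.-1], so failure at [k.-1] reads
[1 + sum_(S :\: Gs k) F j / F i <= N - k.-1], and [c i <= F j / F i]. *)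

Section MinOver.
Context {R : realType} {M : nat} (F : 'I_M -> R).
Implicit Types (A : {set 'I_M}) (i : 'I_M).

Lemma min_over_le A i : i \in A -> min_over F A <= F i.
Proof.
rewrite /min_over => iA; case: pickP => [i0 _|/(_ i)]; last by rewrite iA.
by rewrite (bigD1 i) //= ge_min lexx.
Qed.

Lemma min_over_attained A i :
  i \in A -> exists2 i0, i0 \in A & min_over F A = F i0.
Proof.
rewrite /min_over => iA; case: pickP => [i0 i0A|/(_ i)]; last by rewrite iA.
(* The invariant is that the running minimum is a value of [F] on [A]; the seed [F i0] is one, since
   [pick] chose [i0] in [A]. *)
elim/big_rec: _ => [|j _ jA [k kA ->]]; first by exists i0.
by case: (leP (F j) (F k)) => _; [exists j | exists k].
Qed.

Lemma min_over_eq A i :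
  i \in A -> (forall j, j \in A -> F i <= F j) -> min_over F A = F i.
Proof.
move=> iA imin; apply/le_anti; rewrite min_over_le //=.
by have [j jA ->] := min_over_attained iA; exact: imin.
Qed.

Lemma min_over_ge0 A : (forall i, 0 < F i) -> 0 <= min_over F A.
Proof.
move=> F_gt0; have [->|[i iA]] := set_0Vmem A.
  by rewrite /min_over; case: pickP => // i; rewrite inE.
by have [j _ ->] := min_over_attained iA; exact: ltW.
Qed.

Lemma ratio_sum0 : ratio_sum F set0 = 0.
Proof. by rewrite /ratio_sum big_set0. Qed.

End MinOver.

Lemma ordered_chain_subset {R : realType} {M : nat} (F : 'I_M -> R)
    (S : {set 'I_M}) (Gs : nat -> {set 'I_M}) (k : nat) :
  ordered_chain F S Gs -> (k <= #|S|)%N -> Gs k \subset S.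
Proof.
(* Downward induction from [Gs #|S| = S]: writing [k] as [#|S| - m] turns it into induction on
   [m]. *)
case=> _ GsS GsP _ _ kS; rewrite -(subKn kS).
elim: (#|S| - k)%N => [|m IHm]; first by rewrite subn0 GsS.
rewrite subnS; case: (#|S| - m)%N IHm (leq_subr m #|S|) => //= n IHm nS.
exact: subset_trans (proper_sub (GsP _ nS)) IHm.
Qed.

Section ProportionalFrequencies.
Context {R : realType} {M : nat} {F c : 'I_M -> R} {S : {set 'I_M}} {t : R}.
Hypotheses (F_gt0 : forall i, 0 < F i) (t_le1 : t <= 1).
Hypothesis cE : forall i, i \in S -> c i = t * min_over F S / F i.

Lemma freq_le_ratio {i} : i \in S -> c i <= min_over F S / F i.
Proof.
move=> iS; rewrite cE // ler_pM2r ?invr_gt0 //.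
by rewrite ler_piMl // min_over_ge0.
Qed.

Lemma freq_le1 {i} : i \in S -> c i <= 1.
Proof.
move=> iS; apply: le_trans (freq_le_ratio iS) _.
by rewrite ler_pdivrMr // mul1r min_over_le.
Qed.

(** In [c i <= min_over F S / F i <= 1] both inequalities become equalities; the second identifies
    [F i], and then [c i] reduces to [t]. *)
Lemma freq_eq1 {i} : i \in S -> c i = 1 -> t = 1 /\ F i = min_over F S.
Proof.
move=> iS ci1.
have Fi : F i = min_over F S.
  apply/le_anti; rewrite min_over_le // andbT.
  have := freq_le_ratio iS; rewrite ci1.
  by rewrite ler_pdivlMr // mul1r.
by split=> //; rewrite -ci1 cE // -Fi mulfK // gt_eqF.
Qed.

Lemma sampling_condition_sum_le N (G : {set 'I_M}) :
  G \subset S -> sampling_condition F c S G N -> \sum_(i in S) c i <= N.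
Proof.
move=> GS [sumN _]; rewrite (big_setID G) /= (setIidPr GS).
rewrite -(subrK #|G|%:R N) addrC lerD //.
rewrite -sum1_card natr_sum ler_sum // => i iG.
exact/freq_le1/(subsetP GS).
Qed.

Lemma sampling_condition_freq1_sub N (G : {set 'I_M}) :
  sampling_condition F c S G N -> [set i in S | c i == 1] \subset G.
Proof.
move=> [sumN Nlt]; apply/subsetP => i; rewrite inE => /andP[iS /eqP ci1].
have [t1 Fi] := freq_eq1 iS ci1.
apply: contraLR (le_lt_trans sumN Nlt) => iG; rewrite -leNgt le_eqVlt.
apply/orP; left; apply/eqP/eq_bigr => j jSG.
have -> : min_over F (S :\: G) = F i.
  apply: min_over_eq => [|h]; rewrite !inE ?iG // => /andP[_ hS].
  by rewrite Fi min_over_le.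
by rewrite cE ?t1 ?mul1r ?Fi //; case/setDP: jSG.
Qed.

Lemma chain_smallest_sampling N (Gs : nat -> {set 'I_M}) :
  N < #|S|%:R -> \sum_(i in S) c i <= N -> ordered_chain F S Gs ->
  exists k : nat,
    smallest_upto #|S| (fun k => N - k%:R < ratio_sum F (S :\: Gs k)) k /\
    sampling_condition F c S (Gs k) N.
Proof.
move=> NS sumN GsC; have [Gs0 GsS GsP Gs_card Gs_le] := GsC.
(* The bound on [k] is part of [P], because the chain is unconstrained beyond [#|S|]. *)
pose P k := (k <= #|S|)%N && (N - k%:R < ratio_sum F (S :\: Gs k)).
have exP : exists k, P k.
  by exists #|S|; rewrite /P leqnn GsS setDv ratio_sum0 subr_lt0.
case: (ex_minnP exP) => k /andP[kS Pk] k_min; exists k.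
split; first by split=> // k' k'S Pk'; apply: k_min; rewrite /P k'S.
rewrite /sampling_condition Gs_card //; split=> //.
case: k kS Pk k_min => [|k] kS _ k_min; first by rewrite Gs0 setD0 subr0.
have [_ [j jG jNG]] := properP (GsP _ kS).
have GE : Gs k.+1 = j |: Gs k.
  apply/eqP; rewrite eq_sym eqEcard subUset sub1set jG proper_sub ?GsP //=.
  by rewrite cardsU1 jNG !Gs_card // ltnW.
have jS : j \in S := subsetP (ordered_chain_subset GsC kS) _ jG.
have jSG : j \in S :\: Gs k by rewrite inE jNG.
have SGE : S :\: Gs k.+1 = (S :\: Gs k) :\ j by rewrite GE setUC setDDl.
(* The chain order is used at [k.+1], not [k]: there [j] is already inside, and every other [h] of
   [S :\: Gs k] is still outside. *)
have minE : min_over F (S :\: Gs k) = F j.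
  apply: min_over_eq => // h hSG; have [->//|hj] := eqVneq h j.
  by apply: Gs_le kS jG _; rewrite SGE !inE hj; rewrite inE in hSG.
have : ratio_sum F (S :\: Gs k) <= N - k%:R.
  rewrite leNgt; apply/negP => Pk.
  by have := k_min k; rewrite /P (ltnW kS) Pk ltnn => /(_ isT).
rewrite /ratio_sum (big_setD1 j) //= minE divff ?gt_eqF // -SGE => le_N.
rewrite -natr1 opprD addrA lerBrDl; apply: le_trans le_N.
rewrite lerD2l ler_sum // => i /setDP[iS _].
(* The minimum over all of [S] is at most [F j], as [j] lies in [S]. *)
apply: le_trans (freq_le_ratio iS) _.
by rewrite ler_pM2r ?invr_gt0 // min_over_le.
Qed.

End ProportionalFrequencies.

(** Each branch is 0, 1 or capped by 1, except the interior [y = (theta / r) * x], where the cap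
    [r / theta] on [x] gives the bound. *)
Lemma xy_le1 {R : realType} {M : nat} (l u : nat) (K r : R) (I J : 'I_M -> R)
    (A : {set 'I_M}) :
  0 < r -> (forall i, 0 < I i) -> (forall i, 0 < J i) ->
  (xy l u K r I J A).1 <= 1 /\ (xy l u K r I J A).2 <= 1.
Proof.
move=> r_gt0 I_gt0 J_gt0; rewrite /xy.
set th := min_over I A / _.
have th_ge0 : 0 <= th by rewrite divr_ge0 // min_over_ge0.
clearbody th.
case: ifP => _.
  by rewrite /xy_fixed_size; case: ifP; rewrite !ge_min !lexx !orbT.
case: ifP => _.
  rewrite /xy_interior /=; split; first by rewrite !ge_min lexx !orbT.
  (* The default minimum 0 over an empty set can make [th] zero; then [y = 0]. *)
  move: th_ge0; rewrite le_eqVlt => /predU1P[<-|th_gt0].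
    by rewrite !mul0r ler01.
  rewrite -ler_pdivlMl ?divr_gt0 // mulr1 invf_div.
  by rewrite !ge_min lexx !orbT.
by case: ifP => _; rewrite /xy_lower /xy_upper; do 2?case: ifP => _ /=;
  rewrite ?ge_min ?lexx ?ler01 ?orbT.
Qed.

Theorem mainTheorem3 (R : realType) (M l u : nat) (K r : R) (I J : 'I_M -> R)
    (D : {set 'I_M})
    (hlu : (l <= u)%N) (huM : (u <= M)%N) (hlM : (l < M)%N) (hu : (0 < u)%N)
    (hK : 0 < K <= M%:R) (hr : 0 < r)
    (hI : forall i : 'I_M, 0 < I i) (hJ : forall i : 'I_M, 0 < J i)
    (hD : D \in admissible M l u) :
  let c := cstar l u K r I J D in
  ( (* (i) *)
    (forall (N : R) (G : {set 'I_M}),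
        0 <= N <= #|D|%:R -> G \subset D ->
        sampling_condition I c D G N ->
        \sum_(i in D) c i <= N /\ [set i in D | c i == 1] \subset G) /\
    (forall (N : R) (G : {set 'I_M}),
        0 <= N <= #|~: D|%:R -> G \subset ~: D ->
        sampling_condition J c (~: D) G N ->
        \sum_(i in ~: D) c i <= N /\ [set i in ~: D | c i == 1] \subset G)) /\
  ( (* (ii) *)
    (forall (N : R) (Gs : nat -> {set 'I_M}),
        N < #|D|%:R -> \sum_(i in D) c i <= N ->
        ordered_chain I D Gs ->
        exists k : nat,
          smallest_upto #|D|
            (fun k => N - k%:R < ratio_sum I (D :\: Gs k)) k /\
          sampling_condition I c D (Gs k) N) /\
    (forall (N : R) (Gs : nat -> {set 'I_M}),
        N < #|~: D|%:R -> \sum_(i in ~: D) c i <= N ->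
        ordered_chain J (~: D) Gs ->
        exists k : nat,
          smallest_upto #|~: D|
            (fun k => N - k%:R < ratio_sum J (~: D :\: Gs k)) k /\
          sampling_condition J c (~: D) (Gs k) N)).
Proof.
move=> c; have [x_le1 y_le1] := xy_le1 l u K D hr hI hJ.
(* The factor [t] is [x(D)] on [D] and [y(D)] on [~: D]. *)
have cI i : i \in D -> c i = (xy l u K r I J D).1 * min_over I D / I i.
  by rewrite /c /cstar => ->.
have cJ i : i \in ~: D -> c i = (xy l u K r I J D).2 * min_over J (~: D) / J i.
  by rewrite inE /c /cstar => /negbTE ->.
split; split=> N G.
- move=> _ GD hG; split; first exact: (sampling_condition_sum_le hI x_le1 cI GD hG).
  exact: (sampling_condition_freq1_sub hI x_le1 cI hG).
- move=> _ GD hG; split; first exact: (sampling_condition_sum_le hJ y_le1 cJ GD hG).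
  exact: (sampling_condition_freq1_sub hJ y_le1 cJ hG).
- exact: (chain_smallest_sampling hI x_le1 cI).
- exact: (chain_smallest_sampling hJ y_le1 cJ).
Qed.
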